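(* Let $A$ be a nonempty finite subset of an abelian group $(G,+)$ and let $h\ge 2$ be an integer. Then $$|(h-1)A|\ge \frac{h}{x}\,|hA|,$$ where $x\in\mathbb{R}$ satisfies $x\ge h$ and $|hA|=\binom{x}{h}$.
   Context: For an integer $h\ge 1$, $hA=\{x_1+\dots+x_h \mid x_1,\dots,x_h\in A\}$ denotes the $h$-fold iterated sumset of $A$. For $m\in\mathbb{N}$ and $x\in\mathbb{R}$, $\binom{x}{m}=\frac{x(x-1)\cdots(x-m+1)}{m!}$. For every integer $h\ge1$ and positive integer $d$ there is a unique real number $x\ge h$ with $\binom{x}{h}=d$. *)

(* Defs.v *)
From HB Require Import structures.
From mathcomp Require Import all_boot all_order all_algebra.
From mathcomp Require Import finmap.
From mathcomp Require Import reals.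

Set Implicit Arguments.
Unset Strict Implicit.
Unset Printing Implicit Defensive.

Import Order.TTheory GRing.Theory Num.Theory.
Local Open Scope fset_scope.
Local Open Scope ring_scope.

(* The index f ranges over the h-tuples of elements of A (A coerces to the
   finType of its elements); in particular sumset 0 A is the singleton of 0. *)
Definition sumset (G : zmodType) (h : nat) (A : {fset G}) : {fset G} :=
  [fset \sum_(i < h) val (f i) | f : {ffun 'I_h -> A} in {: {ffun 'I_h -> A}}].

Definition binomr (R : realType) (x : R) (m : nat) : R :=
  (\prod_(i < m) (x - i%:R)) / m`!%:R.

(* Main.v *)
Require Import Defs.
From mathcomp Require Import all_boot all_order all_algebra.
From mathcomp Require Import finmap.
From mathcomp Require Import boolp reals.
From mathcomp Require Import zify ring lra.

(* Write the elements of hA as values of monomials of degree h in variables indexed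
   by A, and pick for each of them the representation that is smallest for an
   additive weight. A divisor of a chosen monomial is again chosen, so the chosen
   monomials of degree h - 1 contain the shadow of those of degree h, and it
   remains to bound the shadow of a set F of monomials from below.
   With phi_h (binom(x, h)) = binom(x - 1, h - 1), the claim is |shadow F| >= phi_h |F|.
   Fix a variable v, let F0 be the monomials of F not divisible by v and
   F1 = {m / v | m in F, v | m}. The shadow contains F1, and disjoint copies of the
   shadows of F0 and F1; by induction its size is at least
   max (|F1|, phi_h |F0| + phi_(h-1) |F1|), and concavity of phi_h shows that
   this is at least phi_h (|F0| + |F1|) = phi_h |F|. *)

Set Implicit Arguments.
Unset Strict Implicit.

Import Order.TTheory GRing.Theory Num.Theory.
Local Open Scope fset_scope.
Local Open Scope ring_scope.

(** * Real binomial coefficients and their concavity *)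

Section FallingFactorial.
Variable R : realType.
Implicit Types (x t s : R) (k h : nat).

Lemma falling_ge0 x k : k%:R <= x + 1 -> 0 <= \prod_(i < k) (x - i%:R).
Proof.
move=> kx; apply: prodr_ge0 => i _; have := ltn_ord i.
rewrite -(ler_nat R) -natr1; lra.
Qed.

(** Both sides agree at [s = 0] and at [s = 1]. In the induction on [k], comparing the new factors
    leaves only the nonnegative term [s * (k + 1) * (1 - s)]. *)
Lemma falling_concave t s k : k%:R <= t + 1 -> 0 <= s <= 1 ->
  (t + 1) * \prod_(i < k) (t - i%:R)
    <= (t + 1 - k%:R * s) * \prod_(i < k) (t + s - i%:R).
Proof.
move=> kt /andP[s0 s1]; elim: k kt => [|k IH] kt; first by rewrite !big_ord0; lra.
rewrite -natr1 in kt *; have k0 : 0 <= k%:R :> R by [].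
have {}IH := IH ltac:(lra).
have T0 : 0 <= \prod_(i < k) (t - i%:R) by apply: falling_ge0; lra.
rewrite !big_ord_recr /=.
set T := \prod_(i < k) _ in IH T0 *; set W := \prod_(i < k) _ in IH *.
have A0 : 0 < t + 1 - k%:R * s.
  by have : k%:R * s <= k%:R by [rewrite ler_piMr]; lra.
rewrite -(ler_pM2l A0).
have -> : (t + 1 - k%:R * s) * ((t + 1) * (T * (t - k%:R)))
  = ((t + 1) * T) * ((t - k%:R) * (t + 1 - k%:R * s)) by ring.
set c := (t + 1 - (k%:R + 1) * s).
have -> : (t + 1 - k%:R * s) * (c * (W * (t + s - k%:R)))
  = ((t + 1 - k%:R * s) * W) * (c * (t + s - k%:R)) by ring.
have c0 : 0 <= c.
  by have : (k%:R + 1) * s <= k%:R + 1 by [rewrite ler_piMr//; lra]; rewrite /c; lra.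
have tT0 : 0 <= (t + 1) * T by apply: mulr_ge0 => //; lra.
apply: ler_pM => //; first by apply: mulr_ge0; lra.
rewrite -subr_ge0; suff -> : c * (t + s - k%:R) - (t - k%:R) * (t + 1 - k%:R * s)
  = s * (k%:R + 1) * (1 - s) by rewrite !mulr_ge0//; lra.
by rewrite /c; ring.
Qed.

Lemma binomrS x h : binomr x h.+1 = x / h.+1%:R * binomr (x - 1) h.
Proof.
rewrite /binomr big_ord_recl /= subr0 factS natrM invfM.
under eq_bigr => i _ do rewrite /bump /= add1n -natr1 opprD addrA addrAC.
by ring.
Qed.

Lemma binomrSr x h : binomr x h.+1 = (x - h%:R) / h.+1%:R * binomr x h.
Proof. by rewrite /binomr big_ord_recr /= factS natrM invfM; ring. Qed.

Lemma binomr_pascal x h : binomr x h.+1 = binomr (x - 1) h + binomr (x - 1) h.+1.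
Proof.
rewrite binomrS (binomrSr (x - 1)).
have : h.+1%:R != 0 :> R by rewrite pnatr_eq0.
rewrite -natr1 => h0; by field.
Qed.

Lemma binomr_nat h : binomr h%:R h = 1 :> R.
Proof.
elim: h => [|h IH]; first by rewrite /binomr big_ord0 fact0 divr1.
by rewrite binomrS -natr1 addrK IH mulr1 divff// natr1 pnatr_eq0.
Qed.

(** For fixed [h] the binomial is a polynomial in its first argument, so the intermediate value
    theorem for polynomials applies. *)
Lemma binomr_ivt (a b v : R) h : a <= b -> binomr a h <= v <= binomr b h ->
  exists2 z, a <= z <= b & binomr z h = v.
Proof.
pose p : {poly R} := (h`!%:R)^-1 *: \prod_(i < h) ('X - (i%:R)%:P) - v%:P.
have pE z : p.[z] = binomr z h - v.
  rewrite !hornerE horner_prod /binomr mulrC; congr (_ * _ - _).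
  by apply: eq_bigr => i _; rewrite !hornerE.
move=> ab /andP[av vb]; have [] := @poly_ivt _ p a b ab.
  by rewrite !pE; apply/andP; split; lra.
move=> z zab; rewrite /root pE subr_eq0 => /eqP zv.
by exists z.
Qed.

(* Concavity of [binomr x h |-> binomr (x - 1) h.-1], combined with the
   monotonicity of [y |-> (h - 1) / y]. *)
Lemma binomr_split x y z h : h.+2%:R <= x -> h.+1%:R <= y <= x - 1 ->
  x - 1 <= z <= x -> binomr x h.+2 = binomr z h.+2 + binomr y h.+1 ->
  binomr (x - 1) h.+1 <= binomr (z - 1) h.+1 + binomr (y - 1) h.
Proof.
move=> hx /andP[hy yx] /andP[xz zx] E.
have h0 : 0 <= h%:R :> R by [].
rewrite -!natr1 in hx hy.
have Y : (h%:R + 1) * binomr y h.+1 <= (x - 1) * binomr (y - 1) h.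
  rewrite binomrS -natr1.
  have Y0 : 0 <= binomr (y - 1) h by rewrite divr_ge0 ?falling_ge0//; lra.
  have -> : (h%:R + 1) * (y / (h%:R + 1) * binomr (y - 1) h) = y * binomr (y - 1) h.
    by field; lra.
  exact: ler_wpM2r.
(* On the curve [w |-> (binomr w h.+2, binomr (w - 1) h.+1)] the chord from [w = x - 1] to [w = x]
   has slope [(h + 1) / (x - 1)]. With [X], this puts the point [w = z] on or above that chord; [Y]
   bounds the slope times [binomr y h.+1]. *)
have C : (x - 1) * binomr (x - 2) h.+1
    <= (x - 1 - (h%:R + 1) * (z - x + 1)) * binomr (z - 1) h.+1.
  have := @falling_concave (x - 2) (z - x + 1) h.+1.
  rewrite -natr1 => /(_ ltac:(lra) ltac:(apply/andP; lra)).
  have -> : x - 2 + 1 = x - 1 by ring.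
  have -> : x - 2 + (z - x + 1) = z - 1 by ring.
  by move=> ineq; rewrite /binomr !mulrA ler_wpM2r// invr_ge0.
have X : (x - h%:R - 2) * binomr (x - 1) h.+1 = (x - 1) * binomr (x - 2) h.+1.
  rewrite binomrS (binomrSr (x - 2)).
  have -> : x - 1 - 1 = x - 2 by ring.
  by ring.
move: E; rewrite !(binomrS _ h.+1) -!natr1 => E.
have {}E : (h%:R + 2) * binomr y h.+1 = x * binomr (x - 1) h.+1 - z * binomr (z - 1) h.+1.
  have -> : binomr y h.+1 = x / (h%:R + 1 + 1) * binomr (x - 1) h.+1
    - z / (h%:R + 1 + 1) * binomr (z - 1) h.+1 by rewrite E; ring.
  by field; lra.
rewrite -(ler_pM2l (x := (h%:R + 2) * (x - 1))); last by rewrite mulr_gt0; lra.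
move: X Y C E.
set b := binomr y _; set b' := binomr (y - 1) _; set W := binomr (z - 1) _.
set X' := binomr (x - 1) _; set T := binomr (x - 2) _.
move: (h%:R : R) h0 => k k0 X Y C E.
have := ler_wpM2l (x := k + 2) ltac:(lra) Y.
have -> : (k + 2) * ((k + 1) * b) = (k + 1) * (x * X' - z * W) by rewrite -E; ring.
move=> Y'; rewrite mulrDr; nra.
Qed.

End FallingFactorial.

(** * Families of monomials and the lower bound for their shadows *)

Lemma sumn_incr_nth (m : seq nat) (i : nat) : sumn (incr_nth m i) = (sumn m).+1.
Proof.
elim: m i => [|k m IH] [|i] //=; last by rewrite IH addnS.
by rewrite -cat_nseq sumn_cat sumn_nseq.
Qed.

(* A monomial in [n] variables is encoded by its exponent sequence, of size [n];
   dividing it by the [i]-th variable is the inverse of [incr_nth _ i]. *)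
Definition contains_shadow (F L : seq (seq nat)) :=
  forall m i, (i < size m)%N -> incr_nth m i \in F -> m \in L.

(** [free_part] and [link] are F0 and F1 for v the first variable. The former loses a variable and
    the latter a degree, which suits a double induction. *)
Definition free_part (F : seq (seq nat)) : seq (seq nat) :=
  [seq behead m | m <- F & head 0%N m == 0%N].

Definition link (F : seq (seq nat)) : seq (seq nat) :=
  [seq (head 0%N m).-1 :: behead m | m <- F & head 0%N m != 0%N].

Section Decomposition.
Variables (n : nat) (F : seq (seq nat)).
Hypothesis sizeF : {in F, forall m, size m = n.+1}.

Lemma mem_free_part m : (m \in free_part F) = (0%N :: m \in F).
Proof.
apply/mapP/idP => [[m']|mF]; last by exists (0%N :: m); rewrite ?mem_filter.
rewrite mem_filter => /andP[/eqP h0 mF] ->; have := sizeF mF; move: h0 mF.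
by case: m' => //= k m' ->.
Qed.

Lemma mem_link k m : (k :: m \in link F) = (k.+1 :: m \in F).
Proof.
apply/mapP/idP => [[m']|mF]; last by exists (k.+1 :: m); rewrite ?mem_filter.
rewrite mem_filter => /andP[h0 mF]; have := sizeF mF; move: h0 mF.
by case: m' => //= [[|j]] // m' _ jF _ [-> ->].
Qed.

Lemma size_split : size F = (size (free_part F) + size (link F))%N.
Proof. by rewrite !size_map !size_filter count_predC. Qed.

Lemma uniq_free_part : uniq F -> uniq (free_part F).
Proof.
move=> uF; rewrite map_inj_in_uniq ?filter_uniq// => m1 m2.
rewrite !mem_filter => /andP[/eqP h1 /sizeF s1] /andP[/eqP h2 /sizeF s2].
by case: m1 m2 h1 h2 s1 s2 => [|? ?] [|? ?] //= -> -> _ _ ->.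
Qed.

Lemma uniq_link : uniq F -> uniq (link F).
Proof.
move=> uF; rewrite map_inj_in_uniq ?filter_uniq// => m1 m2.
rewrite !mem_filter => /andP[h1 /sizeF s1] /andP[h2 /sizeF s2].
by case: m1 m2 h1 h2 s1 s2 => [|[|?] ?] [|[|?] ?] //= _ _ _ _ [-> ->].
Qed.

End Decomposition.

Definition homog n h (F : seq (seq nat)) :=
  {in F, forall m, size m = n /\ sumn m = h}.

Lemma homog_free_part n h F : homog n.+1 h F -> homog n h (free_part F).
Proof.
move=> HF m; have sF : {in F, forall m, size m = n.+1} by move=> ? /HF[].
by rewrite (mem_free_part sF) => /HF[[<-] <-].
Qed.

Lemma homog_link n h F : homog n.+1 h.+1 F -> homog n.+1 h (link F).
Proof.
move=> HF m; have sF : {in F, forall m, size m = n.+1} by move=> ? /HF[].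
case: m => [|k m]; last first.
  by rewrite (mem_link sF) => /HF /= [[<-]] /eqP; rewrite addSn eqSS => /eqP.
by move=> /mapP[].
Qed.

(** Together with [contains_shadow_link], this yields the disjoint copies of the two shadows: [L]
    splits into its monomials without and with the first variable. *)
Lemma contains_shadow_free_part n h k F L : homog n.+1 h F -> homog n.+1 k L ->
  contains_shadow F L -> contains_shadow (free_part F) (free_part L).
Proof.
move=> HF HL FL m i im.
rewrite (@mem_free_part n) => [m'F|? /HF[]//].
rewrite (@mem_free_part n) => [|? /HL[]//].
exact: (FL _ i.+1).
Qed.

Lemma contains_shadow_link n h k F L : homog n.+1 h F -> homog n.+1 k L ->
  contains_shadow F L -> contains_shadow (link F) (link L).
Proof.
move=> HF HL FL [|j m] [|i] //= im;
  rewrite !(@mem_link n) => [m'F|? /HL[]//|? /HF[]//].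
  exact: (FL _ 0%N).
exact: (FL _ i.+1).
Qed.

Lemma link_sub n h F L : homog n.+1 h F ->
  contains_shadow F L -> {subset link F <= L}.
Proof.
move=> HF FL [|k m]; first by case/mapP.
by rewrite (@mem_link n) => [mF|? /HF[]//]; apply: (FL _ 0%N).
Qed.

Lemma incr_nth_surj m : sumn m != 0%N ->
  exists m' i, (i < size m')%N /\ m = incr_nth m' i.
Proof.
elim: m => [|[|k] m IH] //= m0; last by exists (k :: m), 0%N.
by have [m' [i [im ->]]] := IH m0; exists (0%N :: m'), i.+1.
Qed.

(** Induction on [n], then on [h]. Allowing any [L] that contains the shadow lets the two parts of
    [L] serve in the induction hypotheses. *)
Lemma macaulay_lovasz (R : realType) n h (F L : seq (seq nat)) (x : R) :
  uniq F -> uniq L -> homog n h.+1 F -> homog n h L -> contains_shadow F L ->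
  h.+1%:R <= x -> (size F)%:R = binomr x h.+1 -> binomr (x - 1) h <= (size L)%:R.
Proof.
elim: n h F L x => [|n IHn] h F L x.
  (* Without variables there is no monomial of positive degree, but the binomial is positive. *)
  move=> _ _ HF _ _ hx E; exfalso.
  have F0 : F = [::] by case: F HF {E} => // m F /(_ m (mem_head _ _)) [/size0nil ->].
  suff : 0 < binomr x h.+1 by rewrite -E F0 ltxx.
  rewrite divr_gt0 ?ltr0n ?fact_gt0//; apply: prodr_gt0 => i _.
  by rewrite subr_gt0 (lt_le_trans _ hx)// ltr_nat.
elim: h F L x => [|h IHh] F L x uF uL HF HL FL hx E.
  (* In degree one the bound is 1, so it suffices that [L] is nonempty. *)
  rewrite /binomr big_ord0 fact0 divr1 ler1n.
  have : size F != 0%N by rewrite -(pnatr_eq0 R) E binomrSr /binomr big_ord0 fact0; lra.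
  case: F HF FL {E uF} => // m F HF FL _.
  have [_ sm] := HF m (mem_head _ _).
  have [|m' [i [im mE]]] := @incr_nth_surj m; first by rewrite sm.
  by have := FL m' i im; rewrite -mE mem_head => /(_ isT); case: (L).
have sF : {in F, forall m, size m = n.+1} by move=> ? /HF[].
have sL : {in L, forall m, size m = n.+1} by move=> ? /HL[].
(* A large link suffices alone, as it lies in [L]. A small one gives [y <= x - 1] below and, by
   Pascal's rule, [z >= x - 1]. *)
have [le_link|lt_link] := lerP (binomr (x - 1) h.+1) (size (link F))%:R.
  apply: le_trans le_link _; rewrite ler_nat.
  exact: uniq_leq_size (uniq_link sF uF) (link_sub HF FL).
move: E; rewrite (size_split F) natrD => E.
have IHfree z := IHn h.+1 (free_part F) (free_part L) z
  (uniq_free_part sF uF) (uniq_free_part sL uL)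
  (homog_free_part HF) (homog_free_part HL) (contains_shadow_free_part HF HL FL).
have IHlink y := IHh (link F) (link L) y
  (uniq_link sF uF) (uniq_link sL uL)
  (homog_link HF) (homog_link HL) (contains_shadow_link HF HL FL).
rewrite (size_split L) natrD.
have h0 : 0 <= h%:R :> R by [].
(* An empty link has no parameter [y >= h + 1], since the binomial is 1 at [h + 1]; the induction on
   [n] then suffices. *)
have [link0|link_neq0] := eqVneq (size (link F)) 0%N.
  by rewrite ler_wpDr// IHfree// -E link0 addr0.
have free_gt : binomr (x - 1) h.+2 < (size (free_part F))%:R.
  by move: E; rewrite binomr_pascal; lra.
have free_ge1 : 1 <= (size (free_part F))%:R :> R.
  rewrite ler1n lt0n -(pnatr_eq0 R) gt_eqF// (le_lt_trans _ free_gt)//.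
  by rewrite divr_ge0// falling_ge0//; move: hx; rewrite -!natr1; lra.
have link_ge1 : 1 <= (size (link F))%:R :> R by rewrite ler1n lt0n.
have [||y hy yE] := @binomr_ivt R h.+1%:R (x - 1) (size (link F))%:R h.+1.
- by move: hx; rewrite -!natr1; lra.
- by rewrite binomr_nat link_ge1 ltW.
have [z [hz xz zx] zE] : exists2 z,
    [/\ h.+2%:R <= z, x - 1 <= z & z <= x] & binomr z h.+2 = (size (free_part F))%:R.
  (* The search for [z] starts at the larger of [h + 2], required by the induction hypothesis, and
     [x - 1], required by [binomr_split]. *)
  have [hx1|hx1] := lerP h.+2%:R (x - 1).
    have x1x : x - 1 <= x by lra.
    have [|z /andP[xz zx] zE] :=
      @binomr_ivt R (x - 1) x (size (free_part F))%:R h.+2 x1x.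
      by rewrite (ltW free_gt) -E lerDl ler0n.
    by exists z => //; split => //; exact: le_trans hx1 xz.
  have [|z /andP[hz zx] zE] :=
    @binomr_ivt R h.+2%:R x (size (free_part F))%:R h.+2 hx.
    by rewrite binomr_nat free_ge1 -E lerDl ler0n.
  by exists z => //; split => //; apply/ltW/(lt_le_trans hx1).
have := @binomr_split R x y z h hx hy _ _.
rewrite zE yE xz zx -E => /(_ isT erefl)/le_trans; apply.
apply: lerD; first exact: IHfree.
by apply: IHlink => //; case/andP: hy.
Qed.

(** * Representations of least weight *)

Section StandardMonomials.
Variables (G : zmodType) (s : seq G).

Definition monomial_sum (m : seq nat) : G := \sum_(i < size s) s`_i *+ nth 0%N m i.

Lemma monomial_sum_incr m i : (i < size s)%N ->
  monomial_sum (incr_nth m i) = s`_i + monomial_sum m.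
Proof.
move=> i_s; rewrite /monomial_sum.
under eq_bigr => j _ do rewrite nth_incr_nth mulrnDr.
rewrite big_split /= (bigD1 (Ordinal i_s)) //= eqxx big1 ?addr0// => j ji.
by have -> : (i == j) = false by apply: contra_neqF ji => /eqP ij; apply: val_inj.
Qed.

Definition represents h g m :=
  [/\ size m = size s, sumn m = h & monomial_sum m = g].

Lemma represents_incr h g m i : (i < size m)%N ->
  represents h.+1 (s`_i + g) (incr_nth m i) <-> represents h g m.
Proof.
move=> im; rewrite /represents size_incr_nth im sumn_incr_nth.
split=> -[sm hm gm]; split => //; rewrite ?hm//; first by case: hm.
  by apply: (addrI s`_i); rewrite -monomial_sum_incr -?sm.
by rewrite monomial_sum_incr -?sm ?gm.
Qed.

(* The value at [b] of the base-[b] digits [m]: a numerical substitute for a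
   monomial order, injective on monomials of degree less than [b]. *)
Definition weight b (m : seq nat) : nat := foldr (fun k w => k + b * w)%N 0%N m.

(** The increment does not depend on [m], so multiplication by a variable preserves weight
    comparisons. *)
Lemma weight_incr b m i : (i < size m)%N ->
  weight b (incr_nth m i) = (b ^ i + weight b m)%N.
Proof.
elim: m i => [|k m IH] [|i] //= im.
by rewrite IH// expnS; lia.
Qed.

Lemma weight_inj b m1 m2 : size m1 = size m2 -> (sumn m1 < b)%N -> (sumn m2 < b)%N ->
  weight b m1 = weight b m2 -> m1 = m2.
Proof.
elim: m1 m2 => [|k1 m1 IH] [|k2 m2] //= [sm] h1 h2 E.
have k1b : (k1 < b)%N by lia.
have k2b : (k2 < b)%N by lia.
have Ek : k1 = k2.
  have := congr1 (modn^~ b) E.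
  by rewrite /= !(mulnC b) (addnC k1) (addnC k2) !modnMDl !modn_small.
rewrite Ek in E *; congr (_ :: _); apply: IH => //; try lia.
by apply/eqP; rewrite -(eqn_pmul2l (m := b)); [apply/eqP; lia | lia].
Qed.

Definition standard b h g m :=
  represents h g m /\ forall m', represents h g m' -> (weight b m <= weight b m')%N.

Lemma standard_exists b h g m : represents h g m -> exists m', standard b h g m'.
Proof.
move=> gm; pose P w := `[< exists2 m', represents h g m' & weight b m' = w >].
have exP : exists w, P w by exists (weight b m); apply/asboolP; exists m.
have [w /asboolP[m' gm' wm'] wmin] := ex_minnP exP.
exists m'; split=> // m2 gm2; rewrite wm'; apply: wmin.
by apply/asboolP; exists m2.
Qed.

Lemma standard_uniq b h g m1 m2 : (h < b)%N ->
  standard b h g m1 -> standard b h g m2 -> m1 = m2.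
Proof.
move=> hb [r1 min1] [r2 min2]; have [s1 h1 _] := r1; have [s2 h2 _] := r2.
apply: (@weight_inj b); rewrite ?s1 ?h1 ?h2//.
by apply/eqP; rewrite eqn_leq min1 ?min2.
Qed.

(** A lighter representation of [g], multiplied by the [i]-th variable, would be a lighter
    representation of [s_i + g]. This gives closure under divisors. *)
Lemma standard_incr b h g m i : (i < size m)%N ->
  standard b h.+1 (s`_i + g) (incr_nth m i) -> standard b h g m.
Proof.
move=> im [/represents_incr gm mmin]; have {}gm := gm im.
split=> // m' gm'; have im' : (i < size m')%N.
  by case: gm gm' => sm _ _ [-> _ _]; rewrite -sm.
by have := mmin _ ((represents_incr h g im').2 gm'); rewrite !weight_incr// leq_add2l.
Qed.

End StandardMonomials.

(** Tuples and exponent sequences are linked through lists of elements of [A], whose enumeration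
    provides the variables. *)
Lemma sumsetP (G : zmodType) h (A : {fset G}) g :
  g \in sumset h A <-> exists m, represents A h g m.
Proof.
split=> [/imfsetP[f _ ->]|].
  have : {subset [seq val (f i) | i <- enum 'I_h] <= A}.
    by move=> _ /mapP[i _ ->]; exact: valP.
  have -> : \sum_(i < h) val (f i) = \sum_(a <- [seq val (f i) | i <- enum 'I_h]) a.
    by rewrite big_map big_enum.
  have : size [seq val (f i) | i <- enum 'I_h] = h by rewrite size_map size_enum_ord.
  move: [seq _ | i <- _] => l; elim: l h {f} => [|a l IH] h.
    move=> <- _; exists (nseq (size A) 0%N); split; rewrite ?size_nseq ?sumn_nseq//.
    by rewrite big_nil /monomial_sum big1// => i _; rewrite nth_nseq if_same.
  case: h => // h [/IH{}IH] lA; have [|m rm] := IH.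
    by move=> x xl; apply: lA; rewrite inE xl orbT.
  exists (incr_nth m (index a A)).
  have aA : a \in (A : seq G) by apply: lA; rewrite mem_head.
  rewrite big_cons -[X in X + _](nth_index 0 aA).
  by apply/represents_incr => //; case: rm => -> _ _; rewrite index_mem.
move=> [m rm].
suff [l [sl lA ->]] : exists l, [/\ size l = h, {subset l <= A} & g = \sum_(a <- l) a].
  apply/imfsetP.
  have lAi (i : 'I_h) : l`_i \in A by apply/lA/mem_nth; rewrite sl.
  exists [ffun i => FSetSub (lAi i)] => //=.
  by rewrite (big_nth 0) big_mkord sl; apply: eq_bigr => i _; rewrite ffunE.
elim: h g m rm => [|h IH] g m rm.
  exists [::]; split=> //; rewrite big_nil; case: rm => sm /eqP /natnseq0P m0 <-.
  by rewrite /monomial_sum big1// => i _; rewrite m0 nth_nseq if_same.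
have [_ hm _] := rm.
have [|m' [i [im mE]]] := @incr_nth_surj m; first by rewrite hm.
move: rm; rewrite mE -[g in represents _ _ g](addrNK (A : seq G)`_i) addrC.
move=> /represents_incr-/(_ im) rm; have [l [sl lA gE]] := IH _ _ rm.
exists ((A : seq G)`_i :: l); split; rewrite /= ?sl//.
  move=> x; rewrite inE => /predU1P[->|/lA//]; apply: mem_nth.
  by case: rm => <-.
by rewrite big_cons -gE addrC addrNK.
Qed.

(** * From shadows to sumsets *)

Unset Implicit Arguments.

Theorem theorem4p12 (R : realType) (G : zmodType) (A : {fset G}) (h : nat) (x : R)
    (A_neq0 : A != fset0) (h_ge2 : (2 <= h)%N)
    (x_geh : h%:R <= x) (card_hA : #|` sumset h A|%:R = binomr x h) :
  #|` sumset (h - 1)%N A|%:R >= (h%:R / x) * #|` sumset h A|%:R.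
Proof.
case: h h_ge2 x_geh card_hA => [//|h _] hx E; rewrite subn1 /=.
have x0 : 0 < x by apply: lt_le_trans hx; rewrite ltr0n.
(* The base [h + 2] exceeds both degrees in play, [h] and [h + 1]. Outside the sumset the choice is
   the dummy value [[::]]. *)
have std k : {f & forall g, g \in sumset k A -> standard A h.+2 k g (f g)}.
  apply: (@choice _ _ (fun g m => g \in sumset k A -> standard A h.+2 k g m)) => g.
  have [/sumsetP[m rm]|] := boolP (g \in sumset k A).
    by have [m' ?] := standard_exists h.+2 rm; exists m'.
  by exists [::].
have [f fP] := std h.+1; have [f' f'P] := std h.
have inj k (u : G -> seq nat) : (forall g, g \in sumset k A -> standard A h.+2 k g (u g)) ->
    {in sumset k A &, injective u}.
  by move=> uP g1 g2 /uP[[_ _ e1] _] /uP[[_ _ e2] _] ue; rewrite -e1 -e2 ue.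
(* The factor [(h + 1) / x] turns [binomr x h.+1] into [binomr (x - 1) h]. *)
rewrite E binomrS -(invf_div x) mulKf; last first.
  by rewrite mulf_neq0 ?invr_eq0 ?pnatr_eq0 ?gt_eqF.
rewrite -[X in _ <= X%:R](size_map f').
apply: (@macaulay_lovasz R (size A) h (map f (sumset h.+1 A))) => //.
- by rewrite map_inj_in_uniq ?fset_uniq//; exact: inj.
- by rewrite map_inj_in_uniq ?fset_uniq//; exact: inj.
- by move=> _ /mapP[g /fP[[? ? _] _] ->].
- by move=> _ /mapP[g /f'P[[? ? _] _] ->].
(* The quotient [m] is standard for [g - s_i], hence by uniqueness it is the monomial chosen by
   [f']. *)
- move=> m i im /mapP[g /fP gf mE].
  rewrite -mE -[g](addrNK (A : seq G)`_i) addrC in gf.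
  have gm := standard_incr im gf.
  have gA : g - (A : seq G)`_i \in sumset h A.
    by apply/sumsetP; exists m; case: gm.
  by apply/mapP; exists (g - (A : seq G)`_i) => //; apply: standard_uniq gm (f'P _ gA).
- by rewrite size_map E.
Qed.
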